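(* Let $n$ be a positive integer and let $\mathcal{H}$ be a finite collection of affine hyperplanes in $\mathbb{R}^n$ satisfying the following condition: for every $v\in \{0,1\}^n$ and every $i\in\{1,\dots,n\}$, there exists a hyperplane $H\in \mathcal{H}$ with $v\in H$ such that the $i$-th coordinate of the normal vector of $H$ is non-zero (i.e., writing $H=\{x\in\mathbb{R}^n : \langle a,x\rangle = b\}$ with $a\in\mathbb{R}^n\setminus\{0\}$, $b\in\mathbb{R}$, one has $a_i\neq 0$). Then $|\mathcal{H}|\ge n/2$.
   Context: An affine hyperplane in $\mathbb{R}^n$ is a set of the form $\{x\in\mathbb{R}^n : \langle a,x\rangle=b\}$ with $a\in\mathbb{R}^n\setminus\{0\}$ (its normal vector, determined up to a non-zero scalar multiple, so whether its $i$-th coordinate is non-zero is well defined) and $b\in\mathbb{R}$. *)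

(* Defs.v *)
From mathcomp Require Import all_boot all_order all_algebra finmap.
From mathcomp Require Import boolp classical_sets reals.

Set Implicit Arguments.
Unset Strict Implicit.
Unset Printing Implicit Defensive.

Import GRing.Theory Num.Theory.

Local Open Scope ring_scope.
Local Open Scope classical_set_scope.

Section Hyperplanes.
Variables (R : realType) (n : nat).
Implicit Types (a x : 'rV[R]_n) (b : R) (H : set 'rV[R]_n).

Definition dotv a x : R := \sum_(i < n) a 0 i * x 0 i.

Definition hyperplane a b : set 'rV[R]_n := [set x | dotv a x = b].

(* A nonempty hyperplane determines its normal vector up to a nonzero scalar,
   and no hyperplane with a != 0 is empty; hence, for fixed i, [a 0 i != 0]
   holds for one normal vector of H iff it holds for all of them. *)
Definition normal_vector H a : Prop :=
  a != 0 /\ exists b, H = hyperplane a b.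

Definition affine_hyperplane H : Prop := exists a, normal_vector H a.

Definition cube01 : set 'rV[R]_n :=
  [set v | forall i, v 0 i = 0 \/ v 0 i = 1].

End Hyperplanes.

(* Main.v *)
(** Multiply the equations of hyperplanes of the collection greedily, as long as
    the product does not vanish on the cube, to get a function [q] of degree at
    most [#|` HH|].  A point of its support lies on no hyperplane used and on
    all those not used, so the support is contained in hyperplanes whose normal
    vectors jointly involve every coordinate; a generic combination of their
    equations is an affine form [l] without zero coefficient such that
    [l * q = 0] on the cube.  Up to a diagonal rescaling, the top-degree part of
    this identity says that the top-degree coefficients of [q] are killed by the
    inclusion operator from [d]-sets to [d+1]-sets, where [d = deg q].  As that
    operator is injective for [2 d < n], [n <= 2 d <= 2 #|` HH|]. *)
From mathcomp Require Import all_boot all_order all_algebra finmap.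
From mathcomp Require Import zify ring.

Set Implicit Arguments.
Unset Strict Implicit.
Unset Printing Implicit Defensive.

Import Order.TTheory GRing.Theory Num.Theory.

Local Open Scope ring_scope.

Section InclusionOperators.
Variables (R : realFieldType) (T : finType).
Implicit Types (p : {set T} -> R) (S U : {set T}).

Definition up p U : R := \sum_(i in U) p (U :\ i).
Definition down p U : R := \sum_(i in ~: U) p (i |: U).

(** Removing [j] and inserting some [i] different from [j] gives the same mixed terms in either
    order. The compositions differ only in the terms returning to [S]: one per insertable element,
    respectively one per removable element. *)
Lemma down_up p S :
  down (up p) S + #|S|%:R * p S = up (down p) S + #|~: S|%:R * p S.
Proof.
have -> : down (up p) S =
    #|~: S|%:R * p S + \sum_(i in ~: S) \sum_(j in S) p (i |: (S :\ j)).
  rewrite mulr_natl -sumr_const -big_split; apply: eq_bigr => i iS.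
  have iNS : i \notin S by rewrite inE in iS.
  rewrite /up big_setU1 //= setU1K //; congr (_ + _).
  apply: eq_bigr => j jS; congr p; apply/setP => k; rewrite !inE.
  by have [->|//] := eqVneq k i; case: eqVneq => // ij; rewrite ij jS in iNS.
have -> : up (down p) S =
    #|S|%:R * p S + \sum_(j in S) \sum_(i in ~: S) p (i |: (S :\ j)).
  rewrite mulr_natl -sumr_const -big_split; apply: eq_bigr => j jS.
  rewrite /down (_ : ~: (S :\ j) = j |: ~: S); last first.
    by apply/setP => k; rewrite !inE negb_and negbK.
  by rewrite big_setU1 ?inE ?jS //= setD1K.
by rewrite exchange_big /=; ring.
Qed.

Lemma sum_up_down p p' : \sum_S p S * up p' S = \sum_S down p S * p' S.
Proof.
under eq_bigr do rewrite big_distrr /=.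
under [RHS]eq_bigr do rewrite big_distrl /=.
rewrite (exchange_big_dep xpredT) //= [RHS](exchange_big_dep xpredT) //=.
apply: eq_bigr => i _.
rewrite (reindex_onto (fun S => i |: S) (fun S => S :\ i)) /=; last first.
  by move=> S iS; rewrite setD1K.
apply: eq_big => [S|S /andP[_ /eqP->] //].
rewrite setU11 /= inE; apply/eqP/idP => [<-|iS]; last by rewrite setU1K.
by rewrite !inE eqxx.
Qed.

(** Pairing [down_up] with [p] and using that [up] and [down] are adjoint gives the identity [E], a
    sum of nonnegative terms with [p S ^+ 2] weighted by [#|T| - 2 * d > 0]. *)
Lemma up_injective p d : (2 * d < #|T|)%N ->
  (forall S, #|S| != d -> p S = 0) -> (forall U, up p U = 0) ->
  forall S, p S = 0.
Proof.
move=> dn p0 up0.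
have E : \sum_S (#|T|%:R - (2 * d)%:R) * p S ^+ 2 + \sum_S down p S ^+ 2 = 0.
  under [X in _ + X]eq_bigr do rewrite expr2.
  rewrite -sum_up_down -big_split big1 // => S _ /=.
  have [Sd|/p0->] := eqVneq #|S| d; last by ring.
  have := down_up p S; rewrite {1}/down big1 // add0r => e.
  have := cardsC S; rewrite Sd in e * => <-.
  rewrite natrD natrM.
  have -> : up (down p) S = d%:R * p S - #|~: S|%:R * p S by rewrite e; ring.
  ring.
have c0 : 0 < #|T|%:R - (2 * d)%:R :> R by rewrite subr_gt0 ltr_nat.
have /eqP := E; rewrite paddr_eq0; last 2 first.
- by apply: sumr_ge0 => S _; rewrite mulr_ge0 ?sqr_ge0 ?ltW.
- by apply: sumr_ge0 => S _; rewrite sqr_ge0.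
case/andP => /eqP e _ S.
have := psumr_eq0P _ e.
move=> /(_ (fun S _ => mulr_ge0 (ltW c0) (sqr_ge0 _)) S isT) /eqP.
by rewrite mulf_eq0 gt_eqF //= sqrf_eq0 => /eqP.
Qed.

End InclusionOperators.

Section MultilinearForms.
Variables (R : realFieldType) (T : finType).
Implicit Types (q : {set T} -> R) (a : T -> R) (b : R) (S U W : {set T}).

(* [q] lists the coefficients of a multilinear polynomial, and [mleval q W] is
   its value at the indicator vector of [W]. *)
Definition mleval q W : R := \sum_(S : {set T} | S \subset W) q S.

(** Coefficients of the product of [q] with the affine form, reduced by [x_i ^ 2 = x_i]: multiplying
    by [x_i] sends both [U :\ i] and [U] to [U]. *)
Definition affmul a b q U : R :=
  \sum_(i in U) a i * (q (U :\ i) + q U) - b * q U.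

Lemma mleval_affmul a b q W :
  mleval (affmul a b q) W = (\sum_(i in W) a i - b) * mleval q W.
Proof.
rewrite /mleval /affmul sumrB -big_distrr /= mulrBl; congr (_ - _).
rewrite (exchange_big_dep (mem W)) /=; last by move=> S i /subsetP; apply.
rewrite big_distrl /=; apply: eq_bigr => i iW; rewrite -big_distrr /=.
(* As [U] runs over the subsets of [W] containing [i], the sets [U :\ i] and [U] list every subset
   of [W] once. *)
congr (_ * _); rewrite big_split /= [RHS](bigID (fun S : {set T} => i \in S)).
rewrite /= addrC; congr (_ + _).
rewrite [RHS](reindex_onto (fun S => S :\ i) (fun S => i |: S)) /=; last first.
  by move=> S /andP[_ iS]; rewrite setU1K.
apply: eq_bigl => S; rewrite !inE eqxx /= andbT subDset.
have -> : [set i] :|: W = W.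
  by apply/setUidPr; rewrite sub1set.
congr andb; apply/idP/eqP => [iS|<-]; first by rewrite setD1K.
by rewrite setU11.
Qed.

Lemma mleval_eq0 q : (forall W, mleval q W = 0) -> forall S, q S = 0.
Proof.
move=> q0 S; have [m] := ubnP #|S|; elim: m S => // m IH S Sm.
have := q0 S; rewrite /mleval (bigD1 S) //= big1 ?addr0 // => U /andP[US UnS].
apply: IH; have := proper_card (_ : U \proper S).
by rewrite properEneq UnS US => /(_ isT); lia.
Qed.

Lemma affmul_deg a b q m : (forall S, (m < #|S|)%N -> q S = 0) ->
  forall U, (m.+1 < #|U|)%N -> affmul a b q U = 0.
Proof.
move=> qm U mU; rewrite /affmul (qm U) ?(ltnW mU) // mulr0 subr0 big1 // => i iU.
by rewrite qm ?addr0 ?mulr0 //; have := cardsD1 i U; rewrite iU; lia.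
Qed.

Lemma affmul_eq0_top a b q m : (forall i, a i != 0) ->
  (forall U, affmul a b q U = 0) -> (forall S, (m < #|S|)%N -> q S = 0) ->
  (2 * m < #|T|)%N -> forall S, #|S| = m -> q S = 0.
Proof.
move=> a0 lq qm mT S Sm.
(* The diagonal rescaling: as [w U = a i * w (U :\ i)], dividing by [w] turns the degree [m.+1] part
   of [affmul] into [up]. *)
pose w S := \prod_(i in S) a i.
have w0 U : w U != 0 by apply/prodf_neq0 => i _.
pose p S := if #|S| == m then q S / w S else 0.
have up0 U : up p U = 0.
  have [Um|Um] := eqVneq #|U| m.+1; last first.
    rewrite /up big1 // => i iU; rewrite /p ifN //.
    by have := cardsD1 i U; rewrite iU; lia.
  apply: (mulfI (w0 U)); rewrite mulr0 -(lq U) /affmul (qm U) ?Um //.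
  rewrite mulr0 subr0 big_distrr /=; apply: eq_bigr => i iU.
  have -> : p (U :\ i) = q (U :\ i) / w (U :\ i).
    by rewrite /p ifT //; have := cardsD1 i U; rewrite iU; lia.
  rewrite addr0 {1}/w (big_setD1 i) //= -/(w _) mulrCA mulrA.
  by rewrite mulrA mulfK // mulrC.
have := up_injective mT (p := p); move=> /(_ _ up0 S).
rewrite /p Sm eqxx => H; have /eqP : q S / w S = 0.
  by apply: H => U /negPf->.
by rewrite mulf_eq0 invr_eq0 (negPf (w0 S)) orbF => /eqP.
Qed.

Lemma affmul_eq0_deg a b q m : (forall i, a i != 0) ->
  (forall U, affmul a b q U = 0) -> (forall S, (m < #|S|)%N -> q S = 0) ->
  (2 * m < #|T|)%N -> forall S, q S = 0.
Proof.
move=> a0 lq; elim: m => [|m IH] qm mT S.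
  have [S0|S0] := posnP #|S|; last exact: qm.
  exact: (affmul_eq0_top a0 lq qm mT).
apply: IH => [U mU|]; last by lia.
have [Um|Um] := eqVneq #|U| m.+1; last by apply: qm; lia.
exact: (affmul_eq0_top a0 lq qm mT).
Qed.

Lemma affmul_supp_deg a b q m : (forall i, a i != 0) ->
  (forall W, mleval q W != 0 -> \sum_(i in W) a i = b) ->
  (forall S, (m < #|S|)%N -> q S = 0) -> (exists W, mleval q W != 0) ->
  (#|T| <= 2 * m)%N.
Proof.
move=> a0 qH qm [W qW]; rewrite leqNgt; apply/negP => mT.
suff q0 : forall S, q S = 0 by move: qW; rewrite /mleval big1 ?eqxx.
apply: affmul_eq0_deg qm mT; [exact: a0|apply: (@mleval_eq0 (affmul a b q))].
move=> U; rewrite mleval_affmul; have [->|/qH->] := eqVneq (mleval q U) 0.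
  by rewrite mulr0.
by rewrite subrr mul0r.
Qed.

End MultilinearForms.

From mathcomp Require Import boolp classical_sets reals.
Require Import Defs.

Local Open Scope classical_set_scope.

Section Covers.
Variables (R : realType) (n : nat).
Implicit Types (a c : 'rV[R]_n) (b : R) (H : set 'rV[R]_n).
Implicit Types (q : {set 'I_n} -> R) (W S : {set 'I_n}).

Definition indv W : 'rV[R]_n := \row_i (i \in W)%:R.

Lemma cube01_indv W : cube01 (indv W).
Proof. by move=> i; rewrite mxE; case: (i \in W); [right|left]. Qed.

Lemma dotv_indv a W : dotv a (indv W) = \sum_(i in W) a 0 i.
Proof.
rewrite /dotv [RHS]big_mkcond /=; apply: eq_bigr => i _; rewrite mxE.
by case: (i \in W); rewrite ?mulr1 ?mulr0.
Qed.

(** A hyperplane containing the current support is skipped; otherwise its equation is multiplied in.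
    The support only shrinks, so alternatives settled earlier persist. *)
Lemma greedy_product (s : seq (set 'rV[R]_n)) :
  (forall H, H \in s -> affine_hyperplane H) ->
  exists q, [/\ exists W, mleval q W != 0,
    forall S, (size s < #|S|)%N -> q S = 0 &
    forall H, H \in s -> (forall W, mleval q W != 0 -> H (indv W)) \/
                         (forall W, mleval q W != 0 -> ~ H (indv W))].
Proof.
elim: s => [|H s IH] aH.
  exists (fun S => (S == finset.set0)%:R); split => //.
    exists finset.set0; rewrite /mleval (bigD1 finset.set0) ?sub0set //= eqxx.
    by rewrite big1 ?addr0 ?oner_neq0 // => S /andP[_ /negPf->].
  by move=> S; case: eqVneq => // ->; rewrite cards0.
have [K Ks|q [qn0 qdeg qs]] := IH; first by apply: aH; rewrite inE Ks orbT.
have [qH|] := pselect (forall W, mleval q W != 0 -> H (indv W)).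
  exists q; split => // [S sS|K]; first by apply: qdeg; exact: ltnW sS.
  by rewrite inE => /predU1P[->|/qs //]; left.
move=> /existsNP[W /not_implyP[qW HW]].
have [a [_ [b Hab]]] := aH H (mem_head _ _).
pose q' := affmul (fun i => a 0 i) b q.
have q'E U : mleval q' U = (dotv a (indv U) - b) * mleval q U.
  by rewrite mleval_affmul dotv_indv.
have sub U : mleval q' U != 0 -> mleval q U != 0 /\ ~ H (indv U).
  rewrite q'E mulf_eq0 negb_or subr_eq0 => /andP[/eqP dU qU]; split => //.
  by rewrite Hab.
exists q'; split.
- exists W; rewrite q'E mulf_neq0 // subr_eq0; apply/eqP => e; apply: HW.
  by rewrite Hab.
- exact: affmul_deg qdeg.
- move=> K; rewrite inE => /predU1P[->|/qs[] h]; first by right=> U /sub[].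
    by left=> U /sub[/h].
  by right=> U /sub[/h].
Qed.

(* Take a combination [a + t c] with [t] avoiding the finitely many
   [- a_j / c_j]. *)
Lemma skew_combination (A : set 'rV[R]_n) :
  (forall i, exists a b, A `<=` hyperplane a b /\ a 0 i != 0) ->
  exists a b, A `<=` hyperplane a b /\ forall i, a 0 i != 0.
Proof.
move=> hA.
suff [a [b [Aab a0]]] : exists a b,
    A `<=` hyperplane a b /\ forall i, i \in enum 'I_n -> a 0 i != 0.
  by exists a, b; split => // i; apply: a0; rewrite mem_enum.
elim: (enum 'I_n) => [|i s [a [b [Aab a0]]]].
  exists 0, 0; split => // v _; rewrite /hyperplane /= /dotv big1 // => j _.
  by rewrite mxE mul0r.
have [c [d [Acd ci]]] := hA i.
(* This [t] exceeds every [|a_j / c_j|], so it equals no [- a_j / c_j]. *)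
pose t := 1 + \sum_j `|a 0 j / c 0 j|.
have tP j : c 0 j != 0 -> a 0 j + t * c 0 j != 0.
  move=> cj; apply/eqP => e.
  have ht : t = - (a 0 j / c 0 j).
    apply: (mulIf cj); rewrite mulNr divfK //; apply/eqP.
    by rewrite -addr_eq0 addrC e.
  have : `|a 0 j / c 0 j| < t.
    rewrite /t (bigD1 j) //= addrCA ltrDl ltr_wpDr ?ltr01 //.
    exact: sumr_ge0.
  by rewrite ht -normrN ltNge ler_norm.
exists (a + t *: c), (b + t * d); split.
  move=> v Av; have av := Aab v Av; have cv := Acd v Av.
  rewrite /hyperplane /= in av cv *; rewrite -av -cv /dotv big_distrr.
  by rewrite -big_split /=; apply: eq_bigr => j _; rewrite !mxE; ring.
move=> j; rewrite !mxE.
rewrite inE => /predU1P[->|/a0 aj]; first exact: tP.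
by have [->|/tP //] := eqVneq (c 0 j) 0; rewrite mulr0 addr0.
Qed.

End Covers.

Theorem theorem1p1 (R : realType) (n : nat) (hn : (0 < n)%N)
    (HH : {fset set 'rV[R]_n})
    (hHH : forall H : set 'rV[R]_n, H \in HH -> affine_hyperplane H)
    (hcov : forall v : 'rV[R]_n, cube01 v -> forall i : 'I_n,
      exists H : set 'rV[R]_n, [/\ H \in HH, H v &
        exists a : 'rV[R]_n, normal_vector H a /\ a 0 i != 0]) :
  n%:R / 2 <= #|` HH|%:R :> R.
Proof.
have [q [[W qW] qdeg qHH]] := greedy_product hHH.
pose A : set 'rV[R]_n := [set v | exists2 U, v = indv R U & mleval q U != 0].
have [|a [b [Aab a0]]] := @skew_combination _ _ A.
  move=> i; have [H [HHH HW [a [[_ [b Hab]] ai]]]] := hcov _ (cube01_indv R W) i.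
  exists a, b; split => //; rewrite -Hab => _ [U -> qU].
  (* [H] meets the support at [indv W], so it cannot avoid the support and must contain it. *)
  by case: (qHH H HHH) => [/(_ U qU)//|/(_ W qW)].
rewrite ler_pdivrMr ?ltr0n // -natrM ler_nat mulnC -[X in (X <= _)%N]card_ord.
apply: (affmul_supp_deg (a := fun i => a 0 i) (b := b) a0 _ qdeg).
  by move=> U qU; rewrite -dotv_indv; apply: Aab; exists U.
by exists W.
Qed.
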